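(* For every $\varepsilon>0$ there is $n_0$ such that every triangle-free graph on $n\ge n_0$ vertices has list chromatic number at most $(2\sqrt{2}+\varepsilon)\sqrt{n}$. *)

(* Defs.v *)
From mathcomp Require Import all_boot finmap.
From mathcomp Require Import boolp.

Set Implicit Arguments.
Unset Strict Implicit.
Unset Printing Implicit Defensive.

Local Open Scope fset_scope.

Record simple_graph := SimpleGraph {
  vertex :> finType;
  adj : rel vertex;
  adj_sym : symmetric adj;
  adj_irrefl : irreflexive adj }.

Definition triangle_free (G : simple_graph) : Prop :=
  forall x y z : G, ~~ [&& adj x y, adj y z & adj z x].

Definition proper_colouring (G : simple_graph) (c : G -> nat) : Prop :=
  forall x y : G, adj x y -> c x != c y.

(* A graph has finitely many vertices and lists are finite, so taking the
   colours in [nat] is no restriction. *)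
Definition choosable (G : simple_graph) (k : nat) : Prop :=
  forall L : G -> {fset nat}, (forall x, k <= #|` L x|) ->
  exists c : G -> nat, (forall x, c x \in L x) /\ proper_colouring c.

Lemma choosable_card (G : simple_graph) : choosable G #|G|.
Proof.
move=> L Lge.
have greedy (s : seq G) : uniq s -> exists c : G -> nat,
    {in s, forall x, c x \in L x} /\ {in s &, injective c}.
  elim: s => [|v s IHs] /=; first by move=> _; exists (fun=> 0).
  case/andP=> vNs us; have [c [cL cI]] := IHs us.
  have lt_s : size s < #|G|.
    have := max_card (mem (v :: s)).
    by rewrite (card_uniqP _) //= vNs.
  have [a aL aN] : exists2 a, a \in L v & a \notin map c s.
    apply: contrapT => noa.
    have sub : {subset enum_fset (L v) <= map c s}.
      by move=> a aL; apply: contrapT => /negP aN; apply: noa; exists a.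
    have := uniq_leq_size (fset_uniq (L v)) sub; rewrite size_map => le_s.
    by have := leq_trans (leq_trans lt_s (Lge v)) le_s; rewrite ltnn.
  exists (fun x => if x == v then a else c x); split.
    move=> x; rewrite inE; case: eqP => [-> //|_ /=]; exact: cL.
  move=> x y; rewrite !inE.
  case: eqP => [->|_]; case: eqP => [-> //|_] /= xs ys.
  - by move=> ac; case/negP: aN; rewrite ac map_f.
  - by move=> ca; case/negP: aN; rewrite -ca map_f.
  - exact: cI.
have [c [cL cI]] := greedy _ (enum_uniq G).
exists c; split=> [x|x y xy]; first by apply: cL; rewrite mem_enum.
apply/eqP => /cI; rewrite !mem_enum => /(_ isT isT) xy0.
by rewrite xy0 adj_irrefl in xy.
Qed.

Lemma choosable_ex (G : simple_graph) : exists k, `[< choosable G k >].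
Proof. by exists #|G|; apply/asboolP; exact: choosable_card. Qed.

Definition list_chromatic_number (G : simple_graph) : nat :=
  ex_minn (choosable_ex G).

(* Main.v *)
Require Import Defs.
From mathcomp Require Import all_boot all_order all_algebra finmap zify lra.
From mathcomp Require Import boolp reals.
Import Order.TTheory GRing.Theory Num.Theory.

(** Put d = floor(sqrt(n/2)).  As long as some colour c occurs in the lists of
    more than d uncoloured neighbours of some vertex, give all of them the
    colour c (they are independent, as the graph is triangle-free) and delete
    c from all lists; this costs at most n/(d+1) colours.  Afterwards every
    colour degree is at most d, so lists of size 2d suffice by Haxell's
    theorem.  Finally n/(d+1) + 2d <= 2 sqrt(2n).

    Haxell's theorem: to extend a partial colouring f of A to a vertex a, grow
    a list of pairs w = (x, c), each in conflict with a nonempty set of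
    vertices of A; these conflict sets, together with a, form the reach.  Each
    new w has its vertex in the reach and conflicts with no pair chosen or
    blocked so far; counting shows that such a w exists.  When w meets no
    conflict in A, either a can be coloured, or recolouring a vertex of the
    reach shrinks an earlier conflict set and leaves the previous ones alone. *)

(** * Haxell's theorem: lists at least twice as long as every colour degree *)

Section Haxell.
Set Implicit Arguments.
Unset Strict Implicit.
Variables (T : finType) (K : choiceType) (e : rel T) (L : T -> {fset K}).
Variables (d : nat) (A : {set T}) (a : T).
Hypotheses (e_sym : symmetric e) (e_irr : irreflexive e) (d_gt0 : 0 < d).
Hypothesis L_big : forall x, 2 * d <= #|` L x|.
Hypothesis L_deg :
  forall x c, c \in L x -> #|[set y | e x y && (c \in L y)]| <= d.
Hypothesis aNA : a \notin A.

Implicit Types (f : T -> K) (w z : T * K) (ws : seq (T * K)).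

(** A partial colouring is encoded by a total [f]: vertices outside [B] carry a dummy colour from
    their list, and edges not inside [B] are ignored. *)
Definition colours (B : {set T}) f : Prop :=
  (forall x, f x \in L x) /\ {in B &, forall x y, e x y -> f x != f y}.

Definition recolour f w : T -> K := fun x => if x == w.1 then w.2 else f x.

Definition conflicts f w := [set u in A | e w.1 u && (f u == w.2)].

Definition reach f ws := a |: \bigcup_(w <- ws) conflicts f w.

(* A pair [(u, w.2)] with [u] in [conflicts f w] is [(u, f u)]. *)
Definition blockers f ws : seq (T * K) :=
  flatten [seq w :: [seq (u, w.2) | u <- enum (conflicts f w)] | w <- ws].

Definition blocked f ws z :=
  has (fun p => e p.1 z.1 && (p.2 == z.2)) (blockers f ws).

(* The most recent pair comes first. *)
Fixpoint alternating f ws : Prop :=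
  if ws is w :: ws' then
    [/\ alternating f ws', w.1 \in reach f ws', w.2 \in L w.1,
        ~~ blocked f ws' w & conflicts f w != set0]
  else True.

Lemma alternating_cat f ws1 ws2 :
  alternating f (ws1 ++ ws2) -> alternating f ws2.
Proof. by elim: ws1 => //= w ws1 IH [/IH]. Qed.

Lemma bigcup_conflicts f ws u :
  (u \in \bigcup_(w <- ws) conflicts f w) =
  has (fun w => u \in conflicts f w) ws.
Proof.
by elim: ws => [|w ws IH]; rewrite ?big_nil ?inE // big_cons inE /= -IH.
Qed.

Lemma eq_reach f g ws : {in ws, conflicts f =1 conflicts g} ->
  reach f ws = reach g ws.
Proof.
move=> eqfg; rewrite /reach; congr (_ |: _); rewrite !big_seq.
by apply: eq_bigr => z zws; rewrite eqfg.
Qed.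

Lemma eq_blocked f g ws : {in ws, conflicts f =1 conflicts g} ->
  blocked f ws =1 blocked g ws.
Proof.
move=> eqfg z; rewrite /blocked; suff -> : blockers f ws = blockers g ws by [].
by congr flatten; apply/eq_in_map => w wws; rewrite eqfg.
Qed.

(** Every condition sees the colouring only through the conflict sets of the pairs in the list, so a
    recolouring that keeps these sets keeps the list valid. *)
Lemma eq_alternating f g ws : {in ws, conflicts f =1 conflicts g} ->
  alternating f ws -> alternating g ws.
Proof.
elim: ws => //= w ws IH eqfg [alt wR wL wB w0].
have eqfg' : {in ws, conflicts f =1 conflicts g}.
  by move=> z zws; apply: eqfg; rewrite inE zws orbT.
rewrite -(eqfg w) ?mem_head // -(eq_reach eqfg') -(eq_blocked eqfg').
by split=> //; exact: IH.
Qed.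

Lemma blockersP f ws p :
  reflect (exists2 w, w \in ws &
             p = w \/ exists2 u, u \in conflicts f w & p = (u, w.2))
          (p \in blockers f ws).
Proof.
apply: (iffP flatten_mapP) => -[w wws]; rewrite ?inE => Hp; exists w => //.
  case/predU1P: Hp => [->|/mapP[u]]; first by left.
  by rewrite mem_enum => uw ->; right; exists u.
rewrite inE; case: Hp => [->|[u uw ->]]; first by rewrite eqxx.
by rewrite map_f ?orbT // mem_enum.
Qed.

(** A common vertex [u] would have [w.2 = f u = z.2], so [(u, z.2)] would block the newer pair
    [w]. *)
Lemma conflicts_disjoint f ws w z : alternating f (w :: ws) -> z \in ws ->
  [disjoint conflicts f w & conflicts f z].
Proof.
case=> _ _ _ wB _ zws; apply/pred0P => u /=; apply/negP.
rewrite !inE => /andP[/and3P[uA wu /eqP fuw] /and3P[_ zu /eqP fuz]].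
case/hasP: wB; exists (u, z.2); last by rewrite /= e_sym wu -fuz fuw eqxx.
apply/blockersP; exists z => //; right; exists u => //.
by rewrite inE uA zu fuz eqxx.
Qed.

Lemma card_reach f ws : alternating f ws ->
  #|reach f ws| = (\sum_(w <- ws) #|conflicts f w|).+1.
Proof.
move=> alt; rewrite /reach cardsU1.
have -> : a \notin \bigcup_(w <- ws) conflicts f w.
  by rewrite bigcup_conflicts; apply/hasPn => w _; rewrite inE (negbTE aNA).
rewrite add1n; congr S; elim: ws alt => [|w ws IH] alt.
  by rewrite !big_nil cards0.
rewrite !big_cons cardsU disjoint_setI0 ?cards0 ?subn0; last first.
  apply/pred0P => u /=; apply/negP; rewrite bigcup_conflicts.
  case/andP=> uw /hasP[z zws uz].
  by have /disjointFr/(_ uw) := conflicts_disjoint alt zws; rewrite uz.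
by rewrite IH //; case: alt.
Qed.

Lemma alternating_size f ws : alternating f ws ->
  size ws <= \sum_(w <- ws) #|conflicts f w|.
Proof.
elim: ws => //= w ws IH [/IH le_ws _ _ _ w0].
by rewrite big_cons -add1n leq_add // card_gt0.
Qed.

(** The conflict sets are disjoint nonempty subsets of [A]. This bound stops the growth of the
    list. *)
Lemma alternating_size_max f ws : alternating f ws -> size ws <= #|A|.
Proof.
move=> alt; rewrite (leq_trans (alternating_size alt)) // -ltnS.
rewrite -card_reach // (leq_trans (n := #|a |: A|)) //; last first.
  by rewrite cardsU1 aNA.
rewrite subset_leq_card // setUS //; apply/subsetP => u.
by rewrite bigcup_conflicts => /hasP[w _]; rewrite inE => /andP[].
Qed.

Lemma alternating_mem f ws w :
  alternating f ws -> w \in ws -> w.2 \in L w.1.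
Proof.
elim: ws => //= z ws IH [/IH{}IH _ zL _ _].
by rewrite inE => /predU1P[->|].
Qed.

(** Let [S] be the total size of the conflict sets. The reach has [S + 1] vertices, whose lists
    supply at least [2 * d * (S + 1)] pairs. There are at most [2 * S] blockers, and by [L_deg] each
    blocks at most [d] of these pairs. *)
Lemma unblocked_ex f ws : colours A f -> alternating f ws ->
  exists w, [/\ w.1 \in reach f ws, w.2 \in L w.1 & ~~ blocked f ws w].
Proof.
move=> [fL _] alt; apply: contrapT => none.
have all_blocked x c : x \in reach f ws -> c \in L x -> blocked f ws (x, c).
  by move=> xR cL; apply: contrapT => /negP xcB; apply: none; exists (x, c).
pose D := blockers f ws.
have D_L p : p \in D -> p.2 \in L p.1.
  case/blockersP=> w wws [->|[u + ->]]; first exact: alternating_mem alt wws.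
  by rewrite inE => /and3P[_ _ /eqP <-]; exact: fL.
have sizeD : size D <= 2 * \sum_(w <- ws) #|conflicts f w|.
  rewrite mul2n -addnn.
  apply: (@leq_trans (size ws + \sum_(w <- ws) #|conflicts f w|)).
    rewrite /D /blockers size_flatten /shape -map_comp sumnE big_map.
    rewrite -sum1_size -big_split /= leq_sum // => z _.
    by rewrite size_map -cardE.
  by rewrite leq_add2r alternating_size.
have lists_covered x : x \in reach f ws ->
    #|` L x| <= \sum_(p <- D) (e p.1 x && (p.2 \in L x)).
  move=> xR.
  have -> : \sum_(p <- D) (e p.1 x && (p.2 \in L x)) =
            size [seq p.2 | p <- D & e p.1 x && (p.2 \in L x)].
    rewrite size_map size_filter -sum1_count [RHS]big_mkcond.
    by apply: eq_bigr => p _; case: (_ && _).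
  apply: uniq_leq_size (fset_uniq _) _ => c cL.
  case/hasP: (all_blocked x c xR cL) => p pD /= /andP[px /eqP pc].
  by apply/mapP; exists p; rewrite // mem_filter px pc pD cL.
have : \sum_(x in reach f ws) 2 * d <= size D * d.
  rewrite -sum1_size big_distrl /=.
  apply: (@leq_trans (\sum_(x in reach f ws) #|` L x|)).
    by apply: leq_sum => x _; exact: L_big.
  apply: (leq_trans (leq_sum (index_enum _) lists_covered)).
  rewrite exchange_big /= !big_seq leq_sum // => p pD; rewrite mul1n.
  apply: leq_trans (L_deg (D_L p pD)).
  rewrite -sum1dep_card [leqRHS]big_mkcond /= big_mkcond leq_sum // => x _.
  by case: (x \in _) => //; case: (_ && _).
rewrite sum_nat_const card_reach // mulnA leq_pmul2r // => le1.
by have := leq_trans le1 sizeD; rewrite mulnC leq_pmul2l // ltnn.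
Qed.

(** * Recolouring a vertex to shrink a conflict set *)

Lemma conflicts_recolour f w z : ~~ (e z.1 w.1 && (w.2 == z.2)) ->
  conflicts (recolour f w) z = conflicts f z :\ w.1.
Proof.
move=> wNz; apply/setP => u; rewrite !inE /recolour.
by have [->|] := eqVneq u w.1; rewrite //= (negbTE wNz) andbF.
Qed.

Lemma recolourP f w (B : {set T}) : B \subset w.1 |: A ->
  w.2 \in L w.1 -> conflicts f w = set0 -> colours A f ->
  colours B (recolour f w).
Proof.
move=> /subsetP BA wL w0 [fL fA]; split=> [x|x y /BA xB /BA yB xy].
  by rewrite /recolour; case: eqP => [->|].
have free u : u \in A -> e w.1 u -> f u != w.2.
  move=> uA wu; apply: contraT => /negPn fu.
  by have := in_set0 u; rewrite -w0 inE uA wu fu.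
rewrite /recolour; move: xB yB; rewrite !inE.
case: eqP => [x_w|_] /=; case: eqP => [y_w|_] //=.
- by rewrite x_w y_w e_irr in xy.
- by move=> _ yA; rewrite eq_sym free // -x_w.
- by move=> xA _; rewrite free // e_sym -y_w.
- by move=> xA yA; exact: fA.
Qed.

Lemma alternating_progress f ws : colours A f -> alternating f ws ->
  (exists g, colours (a |: A) g) \/
  exists g ws1 w ws2, [/\ ws = ws1 ++ w :: ws2, colours A g,
    {in ws2, conflicts g =1 conflicts f}
    & conflicts g w \proper conflicts f w].
Proof.
(* Outer induction on the room left for lengthening the list. *)
have [n] := ubnP (#|A| - size ws).
elim: n f ws => // n IHn f0 ws ws_lt f0A alt0.
have [w [wR wL wB]] := unblocked_ex f0A alt0.
(* Inner induction on the conflict set of the new pair: [w] stays fixed while [f] varies, as long as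
   the conflict sets over [ws] remain those of [f0]. *)
suff: forall m f, #|conflicts f w| < m -> colours A f ->
    {in ws, conflicts f =1 conflicts f0} ->
  (exists g, colours (a |: A) g) \/
  exists g ws1 z ws2, [/\ ws = ws1 ++ z :: ws2, colours A g,
    {in ws2, conflicts g =1 conflicts f}
    & conflicts g z \proper conflicts f z].
  by move/(_ #|conflicts f0 w|.+1 f0); exact.
elim=> // m IHm f; rewrite ltnS => w_le fA eqf.
have alt : alternating f ws.
  by apply: eq_alternating alt0 => z zws; rewrite eqf.
rewrite -(eq_reach eqf) in wR; rewrite -(eq_blocked eqf) in wB.
have [w0|w_neq0] := eqVneq (conflicts f w) set0.
  have [wa|waN] := eqVneq w.1 a.
    by left; exists (recolour f w); apply: recolourP => //; rewrite wa.
  right; move: wR; rewrite /reach inE in_set1 (negbTE waN) /= bigcup_conflicts.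
  case/hasP=> z zws wz.
  have [ws1 [ws2 def_ws]] : exists ws1 ws2, ws = ws1 ++ z :: ws2.
    by case/splitPr: zws => ws1 ws2; exists ws1, ws2.
  (* Each [z'] is itself a blocker, so the unblocked [w] does not clash with it, and giving [w.1]
     the colour [w.2] adds no conflict. *)
  have no_hit z' : z' \in ws ->
      conflicts (recolour f w) z' = conflicts f z' :\ w.1.
    move=> z'ws; apply: conflicts_recolour; apply: contra wB.
    case/andP=> z'w wz'; apply/hasP; exists z'.
      by apply/blockersP; exists z' => //; left.
    by rewrite z'w eq_sym.
  exists (recolour f w), ws1, z, ws2; split=> //.
  - by apply: recolourP => //; exact: subsetUr.
  (* The older conflict sets are disjoint from that of [z], hence miss [w.1] and do not change. *)
  - move=> z' z'ws2; rewrite no_hit; last first.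
      by rewrite def_ws mem_cat inE z'ws2 !orbT.
    rewrite def_ws in alt.
    have := conflicts_disjoint (alternating_cat alt) z'ws2.
    rewrite disjoint_sym => /disjointFl/(_ wz) wNz'.
    apply/setP => u; rewrite in_setD1.
    by case: eqP => [->|] //=; rewrite wNz'.
  - by rewrite no_hit // properD1.
have alt_w : alternating f (w :: ws) by split.
have wws_lt : #|A| - size (w :: ws) < n.
  have := alternating_size_max alt_w; move: ws_lt; rewrite /=; lia.
case: (IHn f (w :: ws) wws_lt fA alt_w) => [|[g [[|v ws1] [z [ws2]]]]].
- by left.
(* The set that shrank is that of [w], and those over [ws] are intact: the inner induction applies
   to [g]. *)
- case=> [[<- <-] gA eqg gw] {wws_lt}.
  case: (IHm g) => // [||| [h [ws1 [z' [ws3 [def_ws hA eqh hz']]]]]].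
  + exact: leq_trans (proper_card gw) w_le.
  + by move=> u uws; rewrite eqg // eqf.
  + by left.
  have ws3_ws u : u \in z' :: ws3 -> u \in ws.
    by rewrite def_ws mem_cat => ->; rewrite orbT.
  right; exists h, ws1, z', ws3; split=> // [u u3|].
    by rewrite eqh // eqg // ws3_ws // inE u3 orbT.
  by rewrite -eqg ?ws3_ws ?mem_head.
- by case=> [[_ ->] gA eqg gz]; right; exists g, ws1, z, ws2.
Qed.

Lemma colours_extend f : colours A f -> exists g, colours (a |: A) g.
Proof.
(* The empty list has no conflict set to shrink, which leaves only the extension to [a]. *)
move=> fA; have [//|[g [ws1 [w [ws2 []]]]]] := @alternating_progress f [::] fA I.
by case: ws1.
Qed.

End Haxell.

Theorem haxell (T : finType) (K : choiceType) (e : rel T) (L : T -> {fset K})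
    (d : nat) : symmetric e -> irreflexive e -> 0 < d ->
  (forall x, 2 * d <= #|` L x|) ->
  (forall x c, c \in L x -> #|[set y | e x y && (c \in L y)]| <= d) ->
  exists f : T -> K,
    (forall x, f x \in L x) /\ forall x y, e x y -> f x != f y.
Proof.
move=> e_sym e_irr d_gt0 L_big L_deg.
suff [f [fL fT]] : exists f, colours e L [set: T] f.
  by exists f; split=> // x y; apply: fT; rewrite inE.
have [n] := ubnP #|[set: T]|; elim: n [set: T] => // n IHn A.
have [->|[a aA]] := set_0Vmem A => A_lt.
  have /choice[f fL] : forall x, exists c, c \in L x.
    move=> x; apply/fset0Pn; rewrite -cardfs_gt0.
    by apply: leq_trans (L_big x); rewrite muln_gt0.
  by exists f; split=> // x; rewrite inE.
have [|f fA] := IHn (A :\ a).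
  by rewrite -ltnS (leq_trans _ A_lt) // ltnS proper_card ?properD1.
rewrite -(setD1K aA).
by apply: (colours_extend _ _ d_gt0) fA => //; rewrite setD11.
Qed.

(** * Triangle-free graphs: removing the large colour degrees *)

Lemma triangle_free_list_colouring (G : simple_graph) (d : nat)
    (U : {set G}) (L : G -> {fset nat}) : triangle_free G -> 0 < d ->
  (forall x, #|U| %/ d.+1 + 2 * d <= #|` L x|) ->
  exists c : G -> nat,
    (forall x, c x \in L x) /\ {in U &, forall x y, adj x y -> c x != c y}.
Proof.
move=> tf d_gt0; have [n] := ubnP #|U|; elim: n U L => // n IHn U L U_lt L_big.
pose N x c := [set y in U | adj x y && (c \in L y)].
have [[x [c dN]]|sparse] := pselect (exists x c, d < #|N x c|).
  have NU : N x c \subset U by apply/subsetP => y; rewrite inE => /andP[].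
  have cardU := cardsID (N x c) U; rewrite (setIidPr NU) in cardU.
  have [||g [gL gU]] := IHn (U :\: N x c) (fun y => L y `\ c)%fset.
  - by rewrite -ltnS (leq_trans _ U_lt) // ltnS; lia.
  (* At least [d.+1] vertices leave [U], so the quotient drops by at least one, which pays for the
     deleted colour. *)
  - move=> y; have := L_big y; rewrite (cardfsD1 c (L y)) -cardU.
    have : (#|U :\: N x c| + d.+1) %/ d.+1 <= (#|N x c| + #|U :\: N x c|) %/ d.+1.
      by apply: leq_div2r; lia.
    by rewrite divnDr // divnn /=; case: (c \in L y) => /=; lia.
  exists (fun y => if y \in N x c then c else g y); split=> [y|y z yU zU yz].
    case: ifP => [|_]; first by rewrite inE => /and3P[].
    by have := gL y; rewrite !inE => /andP[].
  case: ifPn => yN; case: ifPn => zN.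
  - move: yN zN; rewrite !inE => /and3P[_ xy _] /and3P[_ xz _].
    by have := tf x y z; rewrite xy yz adj_sym xz.
  - by have := gL z; rewrite !inE eq_sym => /andP[].
  - by have := gL y; rewrite !inE => /andP[].
  - by apply: gU => //; rewrite inE ?yN ?zN.
(* Only edges inside [U] are kept, so that each colour degree is at most the size of some
   [N y c]. *)
pose e : rel G := fun x y => [&& x \in U, y \in U & adj x y].
have [||||y c cL|c [cL cU]] := @haxell G nat e L d.
- by move=> x y; rewrite /e adj_sym andbCA.
- by move=> x; rewrite /e adj_irrefl !andbF.
- by [].
- by move=> x; apply: leq_trans (L_big x); exact: leq_addl.
- rewrite leqNgt; apply/negP => deg; apply: sparse; exists y, c.
  apply: leq_trans deg (subset_leq_card _); apply/subsetP => z.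
  by rewrite !inE /e => /andP[/and3P[_ -> ->] ->].
- by exists c; split=> // x y xU yU xy; apply: cU; rewrite /e xU yU.
Qed.

Lemma triangle_free_choosable (G : simple_graph) (d : nat) :
  triangle_free G -> 0 < d -> choosable G (#|G| %/ d.+1 + 2 * d).
Proof.
move=> tf d_gt0 L L_big; have [|c [cL cG]] :=
  @triangle_free_list_colouring G d [set: G] L tf d_gt0.
  by move=> x; rewrite cardsT; exact: L_big.
by exists c; split=> // x y; apply: cG; rewrite inE.
Qed.

(** * From choosability to the numerical bound *)

Lemma list_chromatic_number_min (G : simple_graph) (k : nat) :
  choosable G k -> list_chromatic_number G <= k.
Proof.
by rewrite /list_chromatic_number; case: ex_minnP => m _ min_m /asboolP/min_m.
Qed.

Local Open Scope ring_scope.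

Theorem theorem6p4 (R : realType) (eps : R) (eps_gt0 : 0 < eps) :
  exists n0 : nat, forall G : simple_graph,
    (n0 <= #|G|)%N -> triangle_free G ->
    (list_chromatic_number G)%:R
      <= (2 * Num.sqrt 2 + eps) * Num.sqrt (#|G|%:R : R).
Proof.
(* Two vertices give [s / r >= 1], hence [d >= 1]. *)
exists 2%N => G n_ge2 tf.
set s := Num.sqrt #|G|%:R; set r : R := Num.sqrt 2.
have r_gt0 : 0 < r by rewrite sqrtr_gt0.
have r2 : r * r = 2 by rewrite -expr2 sqr_sqrtr.
have s2 : s * s = #|G|%:R by rewrite -expr2 sqr_sqrtr ?ler0n.
have r_le_s : r <= s by apply: ler_wsqrtr; rewrite ler_nat.
have s_gt0 : 0 < s := lt_le_trans r_gt0 r_le_s.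
pose d := Num.truncn (s / r).
have /andP[d_le d_gt] : d%:R <= s / r < d.+1%:R.
  by apply: truncn_itv; rewrite divr_ge0 // ltW.
have d_gt0 : (0 < d)%N by rewrite truncn_gt0 ler_pdivlMr ?mul1r.
rewrite ler_pdivlMr // in d_le; rewrite ltr_pdivrMr // in d_gt.
have le_ch := list_chromatic_number_min (triangle_free_choosable tf d_gt0).
apply: (@le_trans _ _ (#|G| %/ d.+1 + 2 * d)%:R); first by rewrite ler_nat.
rewrite natrD natrM; set q := (#|G| %/ d.+1)%N.
have q_le : q%:R * d.+1%:R <= s * s by rewrite s2 -natrM ler_nat leq_divM.
have q_ge0 : 0 <= q%:R :> R by [].
have bound_d : 2 * d%:R <= r * s.
  by rewrite -r2 -mulrA ler_pM2l // mulrC.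
(* Since [s < (d + 1) * r], one has [q * s <= q * (d + 1) * r <= s * s * r]; then [s] cancels. *)
have bound_q : q%:R <= r * s.
  rewrite -(ler_pM2r s_gt0); apply: (@le_trans _ _ (q%:R * (d.+1%:R * r))).
    by apply: ler_wpM2l => //; exact: ltW.
  by rewrite mulrA mulrC -mulrA ler_pM2l.
have : 0 < eps * s by exact: mulr_gt0.
by rewrite [leRHS]mulrDl -(mulrA 2 r s); lra.
Qed.
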